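(* Consider the interconnected system $\dot x_i=f_i(x,u_i)$, $i\in\{1,\dots,n\}$, and suppose that every subsystem satisfies conditions (B1) and (B2) of the context, with associated maps $A$, $\Gamma$, $\gamma$ and comparison system $$\dot v_i=-A_i(v_i)+\Gamma_i(v)+\gamma_i(u),\qquad i\in\{1,\dots,n\}.$$ Let $p\in[1,\infty]$ and let $R\in\mathbb{R}^{n\times n}$ be an invertible (entrywise) non-negative matrix. Suppose that there exists $c>0$ such that, for every $v\ge0_n$, $$-\llbracket -A(v),v\rrbracket_{p,R}\ \ge\ \llbracket\Gamma(v),v\rrbracket_{p,R}+c\|v\|_{p,R}^2.\tag{$C_1$}$$ Then: (i) for $u=0_M$, the comparison system (on $\mathbb{R}^n_{\ge 0}$) converges exponentially to $0_n$; (ii) for $u(t)=0_M$, every trajectory of the interconnected system converges to $0_N$; (iii) the interconnected system is input-to-state stable in the sense that, for every $i\in\{1,\dots,n\}$ and $t\ge0$, there exists $L_i>0$ such that $$\|x_i(t)\|_i\le\underline{\alpha}_i^{-1}\Big(L_ie^{-ct}\|V(x(0))\|_{p,R}+\tfrac{L_i(1-e^{-ct})}{c}\max_{\tau\in[0,t]}\|\gamma(u(\tau))\|_{p,R}\Big).$$ Alternatively, if $v\mapsto -A(v)+\Gamma(v)$ is continuously differentiable, then (i), (ii) and (iii) still hold when condition $(C_1)$ is replaced by the following stronger condition: $$\mu^{+}_{p,R}(B(v))\le -c\quad\text{for } v\in\mathbb{R}^n_{\ge0},\tag{$C_2$}$$ where $B(v)\in\mathbb{R}^{n\times n}$ satisfies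 $B(v)v=-A(v)+\Gamma(v)$ for $v\in\mathbb{R}^n_{\ge0}$.
   Context: Setting. For $i\in\{1,\dots,n\}$, $x_i\in\mathbb{R}^{N_i}$ is the state and $u_i\in\mathbb{R}^{M_i}$ the exogenous input of the $i$th subsystem; $N=\sum_iN_i$, $M=\sum_iM_i$, $x=(x_1,\dots,x_n)\in\mathbb{R}^N$, $u=(u_1,\dots,u_n)\in\mathbb{R}^M$. For every $i$, $f_i(0_N,0_{M_i})=0_{N_i}$, and $\mathbb{R}^{N_i}$ carries a norm $\|\cdot\|_i$. Each subsystem has a storage function $V_i:\mathbb{R}^{N_i}\to\mathbb{R}_{\ge0}$, and $V(x)=(V_1(x_1),\dots,V_n(x_n))^{\top}\in\mathbb{R}^n_{\ge0}$, such that: (B1) there are class $\mathcal{K}_\infty$ functions $\underline{\alpha}_i,\overline{\alpha}_i$ with $\underline{\alpha}_i(\|x_i\|_i)\le V_i(x_i)\le\overline{\alpha}_i(\|x_i\|_i)$; (B2) for every $x\in\mathbb{R}^N$, $u\in\mathbb{R}^M$, $\mathcal{L}_{f_i}V_i(x_i)\le-\alpha_i(V_i(x_i))+g_i(V(x))+\gamma_i(u)$ for some function $g_i:\mathbb{R}^n_{\ge0}\to\mathbb{R}$ with $g_i(0_n)=0$ and some class $\mathcal{K}_\infty$ functions $\alpha_i$ and $\gamma_i$. Here $\mathcal{L}_{f_i}V_i$ is the derivative of $V_i$ along $f_i(x,u_i)$, and $\gamma_i(u)$ means the class $\mathcal{K}_\infty$ function $\gamma_i$ evaluated at the magnitude $\|u\|$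 for a fixed norm on $\mathbb{R}^M$; $\gamma(u)=(\gamma_1(u),\dots,\gamma_n(u))^{\top}$. A function $\mathbb{R}_{\ge0}\to\mathbb{R}_{\ge0}$ is of class $\mathcal{K}$ if it is strictly increasing and vanishes at $0$; of class $\mathcal{K}_\infty$ if moreover it tends to $\infty$ at $\infty$. Define $\Gamma,A:\mathbb{R}^n_{\ge0}\to\mathbb{R}^n$ by $\Gamma(v)=(g_1(v),\dots,g_n(v))^{\top}$ and $A(v)=(\alpha_1(v_1),\dots,\alpha_n(v_n))^{\top}$, with components $\Gamma_i(v)=g_i(v)$, $A_i(v_i)=\alpha_i(v_i)$. For $u=0_M$ the comparison system is a positive system, i.e. $\mathbb{R}^n_{\ge0}$ is forward invariant. Weighted norms and pairings. $\|x\|_{p,R}=\|Rx\|_p$. For $p\in(1,\infty)$, $\llbracket x,y\rrbracket_{p,R}=\|y\|_{p,R}^{2-p}(Ry\circ|Ry|^{p-2})^{\top}Rx$ ($\circ$ the entrywise product, $|\cdot|$ and powers entrywise; value $0$ if $y=0_n$); $\llbracket x,y\rrbracket_{1,R}=\|Ry\|_1\,\mathrm{sign}(Ry)^{\top}Rx$; $\llbracket x,y\rrbracket_{\infty,R}=\max_{i\in I_\infty(Ry)}(Ry)_i(Rx)_i$ with $I_\infty(z)=\{i:|z_i|=\|z\|_\infty\}$. Conic matrix measure: $\displaystyle\mu^{+}_{p,R}(B)=\lim_{h\to0^{+}}\ \sup_{x\ge 0_n,\ x\neq 0_n}\frac{\|(I_n+hB)x\|_{p,R}/\|x\|_{p,R}-1}{h}$.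 Inequalities between vectors are entrywise. *)

(* Defs.v *)
From HB Require Import structures.
From mathcomp Require Import all_boot all_order all_algebra.
From mathcomp Require Import all_classical all_reals all_analysis.

Set Implicit Arguments.
Unset Strict Implicit.
Unset Printing Implicit Defensive.

Import Order.TTheory GRing.Theory Num.Theory.
Import numFieldNormedType.Exports.

Local Open Scope classical_set_scope.
Local Open Scope ring_scope.

(* An arbitrary norm on column vectors; the library norm `|v| on 'cV[K]_k is
   the max norm, and the library topology is the usual one. *)
Definition is_norm (K : realType) (k : nat) (N : 'cV[K]_k -> K) : Prop :=
  [/\ forall v, 0 <= N v,
      forall v, N v = 0 -> v = 0,
      forall a v, N (a *: v) = `|a| * N v
    & forall v w, N (v + w) <= N v + N w].

(* Comparison functions have domain [0, +oo[: they are represented by total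
   functions whose values at negative reals are irrelevant. Continuity is not
   part of the definition. *)
Definition class_K (K : realType) (alpha : K -> K) : Prop :=
  alpha 0 = 0 /\ forall r s : K, 0 <= r -> r < s -> alpha r < alpha s.

Definition class_Kinfty (K : realType) (alpha : K -> K) : Prop :=
  class_K alpha /\ alpha r @[r --> +oo] --> +oo.

(* The inverse on [0, +oo[. It is the two-sided inverse when alpha is onto
   [0, +oo[ (i.e. continuous), and always a left inverse (kinvK below). *)
Definition kinv (K : realType) (alpha : K -> K) (s : K) : K :=
  sup [set r : K | 0 <= r /\ alpha r <= s].

Lemma kinvK (K : realType) (alpha : K -> K) (r : K) :
  class_K alpha -> 0 <= r -> kinv alpha (alpha r) = r.
Proof.
move=> [_ mono] r0.
have ubr : ubound [set s : K | 0 <= s /\ alpha s <= alpha r] r.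
  move=> s [s0 ars]; rewrite leNgt; apply/negP => rs.
  by have := mono _ _ r0 rs; rewrite ltNge ars.
have inr : [set s : K | 0 <= s /\ alpha s <= alpha r] r by [].
apply/eqP; rewrite eq_le; apply/andP; split.
  by apply: ge_sup => //; exists r.
by apply: ub_le_sup => //; exists r.
Qed.

Definition orthant (K : realType) (n : nat) : set 'cV[K]_n :=
  [set v | forall i, 0 <= v i 0].

(* p ranges over the extended reals in [1, +oo]; the value at -oo is junk. *)
Definition pnorm (K : realType) (n : nat) (p : \bar K) (x : 'cV[K]_n) : K :=
  match p with
  | r%:E => (\sum_i `|x i 0| `^ r) `^ r^-1
  | +oo%E => \big[Num.max/0]_i `|x i 0|
  | -oo%E => 0
  end.

Definition wnorm (K : realType) (n : nat) (p : \bar K) (R : 'M[K]_n)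
    (x : 'cV[K]_n) : K :=
  pnorm p (R *m x).

(* For p = +oo, the sup is the maximum over a finite set of indices, which is
   nonempty for 0 < n. *)
Definition pairing (K : realType) (n : nat) (p : \bar K) (R : 'M[K]_n)
    (x y : 'cV[K]_n) : K :=
  let Rx := R *m x in
  let Ry := R *m y in
  match p with
  | r%:E =>
      if r == 1 then wnorm p R y * \sum_i Num.sg (Ry i 0) * Rx i 0
      else if y == 0 then 0
      else wnorm p R y `^ (2 - r)
           * \sum_i (Ry i 0 * `|Ry i 0| `^ (r - 2)) * Rx i 0
  | +oo%E =>
      sup [set Ry i 0 * Rx i 0 | i in [set i : 'I_n | `|Ry i 0| = pnorm p Ry]]
  | -oo%E => 0
  end.

Definition conic_measure (K : realType) (n : nat) (p : \bar K) (R B : 'M[K]_n)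
    : K :=
  lim ((fun h : K =>
         sup [set (wnorm p R ((1%:M + h *: B) *m x) / wnorm p R x - 1) / h
             | x in [set x : 'cV[K]_n | orthant x /\ x != 0]]) @ 0^'+).

(* Continuous differentiability on a set that need not be open (here the closed
   orthant), with all limits taken within the set. *)
Definition C1_within (K : realType) (n : nat) (D : set 'cV[K]_n)
    (F : 'cV[K]_n -> 'cV[K]_n) : Prop :=
  exists J : 'cV[K]_n -> 'M[K]_n,
    {within D, continuous J} /\
    forall v, D v -> forall e : K, 0 < e ->
      \forall w \near within D (nbhs v),
        `|F w - F v - J v *m (w - v)| <= e * `|w - v|.

Definition horizon (K : realType) (T : \bar K) : set K :=
  [set t | 0 <= t /\ (t%:E < T)%E].

(* Trajectories live on [0, T[ with T <= +oo; functions of time are total but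
   unconstrained outside [0, T[. *)
Definition trajectory (K : realType) (n : nat) (Nd Md : 'I_n -> nat)
    (f : forall i, 'cV[K]_(\sum_j Nd j) -> 'cV[K]_(Md i) -> 'cV[K]_(Nd i))
    (T : \bar K) (u : K -> 'cV[K]_(\sum_j Md j)) (x : K -> 'cV[K]_(\sum_j Nd j))
    : Prop :=
  {within horizon T, continuous x} /\
  forall (t : K) (i : 'I_n), 0 < t -> (t%:E < T)%E ->
    is_derive t 1 (fun s => submxcol (x s) i) (f i (x t) (submxcol (u t) i)).

Definition storage (K : realType) (n : nat) (Nd : 'I_n -> nat)
    (V : forall i, 'cV[K]_(Nd i) -> K) (x : 'cV[K]_(\sum_j Nd j)) : 'cV[K]_n :=
  \col_i V i (submxcol x i).

Definition diag_map (K : realType) (n : nat) (alpha : 'I_n -> K -> K)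
    (v : 'cV[K]_n) : 'cV[K]_n :=
  \col_i alpha i (v i 0).

Definition gain_map (K : realType) (n : nat) (g : 'I_n -> 'cV[K]_n -> K)
    (v : 'cV[K]_n) : 'cV[K]_n :=
  \col_i g i v.

Definition input_map (K : realType) (n m : nat) (nu : 'cV[K]_m -> K)
    (gamma : 'I_n -> K -> K) (u : 'cV[K]_m) : 'cV[K]_n :=
  \col_i gamma i (nu u).

(* The state space is the orthant, the domain of A and Gamma: solutions take
   their values there. *)
Definition comparison_solution (K : realType) (n m : nat)
    (A Gamma : 'cV[K]_n -> 'cV[K]_n) (gamma : 'cV[K]_m -> 'cV[K]_n)
    (T : \bar K) (u : K -> 'cV[K]_m) (v : K -> 'cV[K]_n) : Prop :=
  [/\ forall t, horizon T t -> orthant (v t),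
      {within horizon T, continuous v}
    & forall t : K, 0 < t -> (t%:E < T)%E ->
        is_derive t 1 v (- A (v t) + Gamma (v t) + gamma (u t))].

(* Main.v *)
(** The storage vector w = V(x) has entrywise derivative at most F(w) + gamma(u)
with F = - A + Gamma. Write N for the weighted norm and [ , ] for the pairing:
the latter satisfies [x, y] <= N x * N y, is sublinear in x, is monotone in x
when y is in the orthant (since R >= 0), and [y, y] = N y ^ 2. Expanding
[w t, w t] <= [w (t - h), w t] + [h w' t + o(h), w t] and dividing by N (w t),
the left upper Dini derivative of N w is at most [w', w] / N w, with no
differentiability of the norm. Either hypothesis gives [F v, v] <= - c N v ^ 2:
C1 by sublinearity, C2 because h [B v, v] <= N v * (N (v + h B v) - N v) and the
supremum defining the conic measure decreases as h decreases to 0. So N w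
satisfies a linear differential inequality, whose integration gives the
estimate; the zero-input and comparison-system statements are special cases. *)
Require Import Defs.
From HB Require Import structures.
From mathcomp Require Import all_boot all_order all_algebra.
From mathcomp Require Import all_classical all_reals all_analysis.
From mathcomp Require Import ring lra.

Set Implicit Arguments.
Unset Strict Implicit.
Unset Printing Implicit Defensive.

Import Order.TTheory GRing.Theory Num.Theory.
Import numFieldNormedType.Exports.

Local Open Scope classical_set_scope.
Local Open Scope ring_scope.

(** * The pairing *)

(** Hölder's inequality for the conjugate exponents [r] and [r / (r - 1)], with the second norm
    rewritten as a power of the [r]-norm of [b]. Dividing by both norms reduces it to Young's
    inequality at each index. *)
Lemma hoelder_sum (K : realType) (n : nat) (r : K) (a b : 'I_n -> K) :
  1 < r ->
  \sum_i `|b i| `^ (r - 1) * `|a i| <=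
  (\sum_i `|a i| `^ r) `^ r^-1 * ((\sum_i `|b i| `^ r) `^ r^-1) `^ (r - 1).
Proof.
move=> r1; have r0 : 0 < r by apply: lt_trans r1.
have rm0 : 0 < r - 1 by rewrite subr_gt0.
set S := \sum_i `|a i| `^ r; set T := \sum_i `|b i| `^ r.
have sum0 (z : 'I_n -> K) : \sum_i `|z i| `^ r = 0 -> forall i, z i = 0.
  move=> /eqP; rewrite psumr_eq0; last by move=> i _; exact: powR_ge0.
  move=> /allP h i; have := h i (mem_index_enum _).
  by rewrite powR_eq0 => /andP[/eqP/normr0_eq0].
have S0 : 0 <= S by apply: sumr_ge0 => i _; exact: powR_ge0.
have T0 : 0 <= T by apply: sumr_ge0 => i _; exact: powR_ge0.
have rhs0 : 0 <= S `^ r^-1 * T `^ r^-1 `^ (r - 1).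
  by rewrite mulr_ge0// powR_ge0.
have [/sum0 a0|/eqP S0'] := pselect (S = 0).
  by rewrite big1// => i _; rewrite a0 normr0 mulr0.
have [/sum0 b0|/eqP T0'] := pselect (T = 0).
  by rewrite big1// => i _; rewrite b0 normr0 powR0 ?gt_eqF// mul0r.
have Sp : 0 < S by rewrite lt_neqAle eq_sym S0' S0.
have Tp : 0 < T by rewrite lt_neqAle eq_sym T0' T0.
set s := S `^ r^-1; set t := T `^ r^-1.
have sp : 0 < s by exact: powR_gt0.
have tp : 0 < t by exact: powR_gt0.
have tp' : 0 < t `^ (r - 1) by exact: powR_gt0.
have sr : s `^ r = S by rewrite -powRrM mulVf ?gt_eqF// powRr1.
have tr : t `^ r = T by rewrite -powRrM mulVf ?gt_eqF// powRr1.
move: s t sp tp tp' sr tr => s t sp tp tp' sr tr.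
have stp : 0 < s * t `^ (r - 1) by exact: mulr_gt0.
suff : (s * t `^ (r - 1))^-1 * \sum_i `|b i| `^ (r - 1) * `|a i| <= 1.
  by rewrite ler_pdivrMl// mulr1.
rewrite mulr_sumr.
pose q := r / (r - 1).
have q0 : 0 < q by exact: divr_gt0.
have pq : r^-1 + q^-1 = 1.
  by rewrite /q invf_div; field; rewrite gt_eqF.
have powV (x y z : K) : 0 <= x -> 0 < y -> (x / y) `^ z = x `^ z / y `^ z.
  move=> x0 y0; rewrite powRM ?invr_ge0 ?(ltW y0)//; congr (_ * _).
  by rewrite -powR_inv1 ?(ltW y0)// powRAC powR_inv1// powR_ge0.
have young i : (s * t `^ (r - 1))^-1 * (`|b i| `^ (r - 1) * `|a i|) <=
    `|a i| `^ r / S / r + `|b i| `^ r / T / q.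
  have := @conjugate_powR K (`|a i| / s) ((`|b i| / t) `^ (r - 1)) r q.
  have ast : 0 <= `|a i| / s by rewrite divr_ge0 ?(ltW sp).
  move=> /(_ ast (powR_ge0 _ _) r0 q0 pq).
  rewrite -powRrM /q (mulrC (r - 1)) divfK ?gt_eqF// !powV// sr tr.
  apply: le_trans; rewrite le_eqVlt; apply/orP; left; apply/eqP.
  by field; rewrite !gt_eqF.
apply: le_trans (ler_sum _ (fun i _ => young i)) _.
rewrite big_split /= -!mulr_suml.
by rewrite -/S -/T !divff// !mul1r pq.
Qed.

Section pairing_theory.
Context (K : realType) (n : nat) (p : \bar K) (p_ge1 : (1 <= p)%E).
Context (R : 'M[K]_n) (R_unit : R \in unitmx).
Implicit Types x y : 'cV[K]_n.

(** The three cases match the branches of [pairing], which treats the exponent 1 apart from the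
    other finite ones. *)
Variant exponent_spec : \bar K -> Type :=
| ExponentOne : exponent_spec 1%:E
| ExponentFin r of 1 < r : exponent_spec r%:E
| ExponentInfty : exponent_spec +oo%E.

Lemma exponentP : exponent_spec p.
Proof.
move: p_ge1; case: p => [r| |//].
- rewrite lee_fin => r1; have [->|r1'] := eqVneq r 1; first exact: ExponentOne.
  by apply: ExponentFin; rewrite lt_neqAle eq_sym r1' r1.
- by move=> _; exact: ExponentInfty.
Qed.

Lemma unitmx_mul_eq0 x : R *m x = 0 -> x = 0.
Proof. by move=> h; rewrite -(mulKmx R_unit x) h mulmx0. Qed.

Lemma wnorm_ge0 x : 0 <= wnorm p R x.
Proof.
rewrite /wnorm; case: exponentP => [|r r1|] /=; rewrite ?powR_ge0//.
by apply: bigmax_ge_id.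
Qed.

Lemma wnormZ (a : K) x : wnorm p R (a *: x) = `|a| * wnorm p R x.
Proof.
rewrite /wnorm -scalemxAr.
have pn (r : K) : 1 <= r ->
    pnorm r%:E (a *: (R *m x)) = `|a| * pnorm r%:E (R *m x).
  move=> r1; have r0 : r != 0 by rewrite gt_eqF// (lt_le_trans _ r1).
  rewrite /pnorm; under eq_bigr do rewrite mxE normrM powRM//.
  rewrite -mulr_sumr powRM ?powR_ge0//; last first.
    by apply: sumr_ge0 => i _; exact: powR_ge0.
  by rewrite -powRrM divff// powRr1.
case: exponentP => [|r r1|]; [exact: pn|by apply: pn; exact: ltW|].
rewrite /=; under eq_bigr do rewrite mxE normrM.
elim/big_ind2 : _ => // [|u u' v v' -> ->]; first by rewrite mulr0.
by rewrite maxr_pMr.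
Qed.

Lemma wnorm0 : wnorm p R 0 = 0.
Proof. by rewrite -(scale0r 0) wnormZ normr0 mul0r. Qed.

Lemma wnorm_eq0 x : wnorm p R x = 0 -> x = 0.
Proof.
move=> h; apply: unitmx_mul_eq0; apply/colP => i; rewrite [RHS]mxE.
move: h; rewrite /wnorm; have pn (r : K) : 1 <= r ->
    pnorm r%:E (R *m x) = 0 -> (R *m x) i 0 = 0.
  move=> r1; have r0 : r != 0 by rewrite gt_eqF// (lt_le_trans _ r1).
  move=> /powR_eq0_eq0/eqP; rewrite psumr_eq0.
    move=> /allP /(_ i (mem_index_enum _)).
    by rewrite powR_eq0 r0 andbT normr_eq0 => /eqP.
  by move=> j _; exact: powR_ge0.
case: exponentP => [|r r1|]; [exact: pn|by apply: pn; exact: ltW|].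
move=> /= h; apply/normr0_eq0/eqP; rewrite eq_le normr_ge0 andbT -h.
exact: le_bigmax.
Qed.

Lemma wnorm_gt0 x : x != 0 -> 0 < wnorm p R x.
Proof.
move=> x0; rewrite lt_neqAle wnorm_ge0 andbT eq_sym.
by apply: contra x0 => /eqP/wnorm_eq0 ->.
Qed.

Lemma powR_wnorm (r : K) x : 0 < r ->
  wnorm r%:E R x `^ r = \sum_i `|(R *m x) i 0| `^ r.
Proof.
move=> r0; rewrite /wnorm /= -powRrM mulVf ?gt_eqF// powRr1//.
by apply: sumr_ge0 => i _; exact: powR_ge0.
Qed.

(** Without indices the supremum is over the empty set, where [sup] takes the default value 0. The
    case is split off because a maximising index exists only for [0 < n]. *)
Lemma pairing_infty0 x y : n = 0%N -> pairing +oo R x y = 0.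
Proof.
move=> n0; rewrite /pairing (_ : [set _ | _ in _] = set0) ?sup0//.
by rewrite -subset0 => ? [i]; have := ltn_ord i; rewrite {2}n0.
Qed.

(** A supremum over a finite nonempty set is a maximum. The index set depends on [y] alone, so by
    the last clause an index maximising for one [x] also bounds the pairing of any other [x] from
    below. *)
Lemma pairing_infty_attained x y : (0 < n)%N ->
  exists i, [/\ `|(R *m y) i 0| = wnorm +oo R y,
    pairing +oo R x y = (R *m y) i 0 * (R *m x) i 0 &
    forall j, `|(R *m y) j 0| = wnorm +oo R y ->
      (R *m y) j 0 * (R *m x) j 0 <= pairing +oo R x y].
Proof.
move=> n0; rewrite /pairing /wnorm; set a := R *m x; set b := R *m y.
pose P : pred 'I_n := fun i => `|b i 0| == pnorm +oo b.
have [i0 Pi0] : exists i, P i.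
  have [i _ h] := @eq_bigmax _ _ _ 0 (Ordinal n0) predT
     (fun i => `|b i 0|) isT (fun i _ => normr_ge0 (b i 0)).
  by exists i; apply/eqP; rewrite /= h.
case: (@arg_maxP _ _ _ i0 P (fun i => b i 0 * a i 0) Pi0) => i /eqP Pi imax.
exists i; set E := [set _ | _ in _].
have ubE : ubound E (b i 0 * a i 0).
  by move=> _ [j /= /eqP Pj <-]; exact: imax.
have -> : sup E = b i 0 * a i 0.
  apply/eqP; rewrite eq_le; apply/andP; split.
    by apply: ge_sup => //; exists (b i 0 * a i 0); exists i.
  by apply: ub_le_sup; [exists (b i 0 * a i 0)|exists i].
by split => // j /eqP; exact: imax.
Qed.

Lemma sum_wnorm1 x : wnorm 1%:E R x = \sum_i `|(R *m x) i 0|.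
Proof.
rewrite -[LHS]powRr1 ?powR_wnorm//; last by rewrite /wnorm /= powR_ge0.
by apply: eq_bigr => i _; rewrite powRr1.
Qed.

Lemma pairing_le x y : pairing p R x y <= wnorm p R x * wnorm p R y.
Proof.
case: exponentP => [|r r1|].
- rewrite /pairing eqxx [leRHS]mulrC; apply: ler_wpM2l.
    by rewrite sum_wnorm1 sumr_ge0.
  rewrite sum_wnorm1; apply: ler_sum => i _.
  apply: le_trans (ler_norm _) _; rewrite normrM normr_sg.
  by case: eqP => _; rewrite ?mul0r ?mul1r.
- have r0 : 0 < r by apply: lt_trans r1.
  rewrite /pairing (gt_eqF r1); have [->|y0] := eqVneq y 0.
    by rewrite mulr_ge0// /wnorm /= powR_ge0.
  set a := R *m x; set b := R *m y.
  have Ny : 0 < wnorm r%:E R y.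
    rewrite lt_neqAle eq_sym powR_ge0 andbT; apply: contra y0 => /eqP.
    rewrite /wnorm => /powR_eq0_eq0/eqP; rewrite psumr_eq0; last first.
      by move=> j _; exact: powR_ge0.
    move=> /allP h; apply/eqP/unitmx_mul_eq0/colP => i; rewrite [RHS]mxE.
    have := h i (mem_index_enum _); rewrite powR_eq0 normr_eq0.
    by case/andP => /eqP.
  have := @hoelder_sum K n r (fun i => a i 0) (fun i => b i 0) r1.
  rewrite -/(pnorm r%:E a) -/(pnorm r%:E b).
  rewrite -/(wnorm r%:E R x) -/(wnorm r%:E R y).
  move=> hs; apply: (@le_trans _ _ (wnorm r%:E R y `^ (2 - r) *
      (wnorm r%:E R x * wnorm r%:E R y `^ (r - 1)))).
    rewrite ler_wpM2l ?powR_ge0//; apply: le_trans hs; apply: ler_sum => i _.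
    apply: le_trans (ler_norm _) _; rewrite !normrM.
    rewrite [X in _ * X * _]ger0_norm ?powR_ge0//.
    rewrite ler_wpM2r//.
    (* Absorbing the factor [|b i|] raises the exponent from [r - 2] to [r - 1]. As [r - 1] is
       positive, this also holds for a vanishing entry. *)
    rewrite (_ : r - 2 = r - 1 - 1); last by ring.
    by rewrite mulr_powRB1// subr_gt0.
  rewrite mulrCA -powRD; last by rewrite (gt_eqF Ny) implybT.
  have -> : 2 - r + (r - 1) = 1 by ring.
  by rewrite powRr1// ltW.
- have [n0|n0] := posnP n.
    by rewrite pairing_infty0// mulr_ge0// /wnorm/= bigmax_ge_id.
  have [i [iy -> _]] := pairing_infty_attained x y n0.
  apply: le_trans (ler_norm _) _; rewrite normrM iy mulrC ler_wpM2r//.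
    by rewrite -iy.
  exact: le_bigmax.
Qed.

Let RD x x' i : (R *m (x + x')) i 0 = (R *m x) i 0 + (R *m x') i 0.
Proof. by rewrite mulmxDr mxE. Qed.

Let RZ h x i : (R *m (h *: x)) i 0 = h * (R *m x) i 0.
Proof. by rewrite -scalemxAr mxE. Qed.

Let RN x i : (R *m (- x)) i 0 = - (R *m x) i 0.
Proof. by rewrite mulmxN mxE. Qed.

(** For finite exponents the pairing is linear in its first argument; at [+oo] it is a maximum of
    linear forms, hence only subadditive. *)
Lemma pairingD x x' y :
  pairing p R (x + x') y <= pairing p R x y + pairing p R x' y.
Proof.
case: exponentP => [|r r1|].
- rewrite /pairing eqxx -mulrDr -big_split le_eqVlt.
  apply/predU1P; left; congr (_ * _).
  by apply: eq_bigr => i _; rewrite RD mulrDr.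
- rewrite /pairing (gt_eqF r1); case: ifP => _; first by rewrite addr0.
  rewrite -mulrDr -big_split le_eqVlt; apply/predU1P; left; congr (_ * _).
  by apply: eq_bigr => i _; rewrite RD mulrDr.
- have [n0|n0] := posnP n; first by rewrite !pairing_infty0// addr0.
  have [i [iy -> _]] := pairing_infty_attained (x + x') y n0.
  rewrite RD mulrDr.
  have [_ [_ _ /(_ _ iy) h]] := pairing_infty_attained x y n0.
  have [_ [_ _ /(_ _ iy) h']] := pairing_infty_attained x' y n0.
  by rewrite lerD.
Qed.

Lemma pairingZ (h : K) x y : 0 <= h ->
  pairing p R (h *: x) y <= h * pairing p R x y.
Proof.
move=> h0; case: exponentP => [|r r1|].
- rewrite /pairing eqxx [leRHS]mulrCA [in leRHS]mulr_sumr le_eqVlt.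
  apply/predU1P; left; congr (_ * _).
  by apply: eq_bigr => i _; rewrite RZ mulrCA.
- rewrite /pairing (gt_eqF r1); case: ifP => _; first by rewrite mulr0.
  rewrite [leRHS]mulrCA [in leRHS]mulr_sumr le_eqVlt.
  apply/predU1P; left; congr (_ * _).
  by apply: eq_bigr => i _; rewrite RZ mulrCA.
- have [n0|n0] := posnP n; first by rewrite !pairing_infty0// mulr0.
  have [i [iy -> _]] := pairing_infty_attained (h *: x) y n0.
  have [_ [_ _ /(_ _ iy) H]] := pairing_infty_attained x y n0.
  by rewrite RZ mulrCA ler_wpM2l.
Qed.

Lemma pairing_diag y : pairing p R y y = wnorm p R y ^+ 2.
Proof.
case: exponentP => [|r r1|].
- rewrite /pairing eqxx expr2; congr (_ * _); rewrite sum_wnorm1.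
  by apply: eq_bigr => i _; rewrite -normrEsg.
- have r0 : 0 < r by apply: lt_trans r1.
  rewrite /pairing (gt_eqF r1); have [->|y0] := eqVneq y 0.
    rewrite /wnorm /= mulmx0; under eq_bigr do rewrite mxE normr0 powR0 ?gt_eqF//.
    by rewrite big1_eq powR0 ?invr_eq0 ?gt_eqF// expr0n.
  have sumE : \sum_i (R *m y) i 0 * `|(R *m y) i 0| `^ (r - 2) * (R *m y) i 0
      = wnorm r%:E R y `^ r.
    rewrite powR_wnorm//; apply: eq_bigr => i _; set b := (R *m y) i 0.
    rewrite mulrAC -expr2 -real_normK ?num_real// expr2.
    rewrite (_ : r - 2 = r - 1 - 1); last by ring.
    by rewrite -mulrA mulr_powRB1 ?subr_gt0// mulr_powRB1.
  rewrite sumE -powRD.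
    by rewrite subrK -powR_mulrn// /wnorm /= powR_ge0.
  by rewrite subrK pnatr_eq0.
- have [n0|n0] := posnP n.
    rewrite pairing_infty0// /wnorm /= big_pred0 ?expr0n// => i.
    by have := ltn_ord i; rewrite {2}n0.
  have [i [iy -> _]] := pairing_infty_attained y y n0.
  by rewrite -iy real_normK ?num_real.
Qed.

(** A maximum of linear forms is not odd in general. On the diagonal it is, because every admissible
    index gives the same value, the squared norm. *)
Lemma pairingN_diag y : pairing p R (- y) y <= - wnorm p R y ^+ 2.
Proof.
rewrite -pairing_diag; case: exponentP => [|r r1|].
- rewrite /pairing eqxx -mulrN -sumrN le_eqVlt.
  apply/predU1P; left; congr (_ * _).
  by apply: eq_bigr => i _; rewrite RN mulrN.
- rewrite /pairing (gt_eqF r1); case: ifP => _; first by rewrite oppr0.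
  rewrite -mulrN -sumrN le_eqVlt; apply/predU1P; left; congr (_ * _).
  by apply: eq_bigr => i _; rewrite RN mulrN.
- have [n0|n0] := posnP n; first by rewrite !pairing_infty0// oppr0.
  have [i [iy -> _]] := pairing_infty_attained (- y) y n0.
  have [j [jy -> _]] := pairing_infty_attained y y n0.
  rewrite RN mulrN lerN2 -2!expr2.
  rewrite -[leLHS]real_normK ?num_real// -[leRHS]real_normK ?num_real//.
  by rewrite iy jy.
Qed.

Lemma orthant_mulmx y : (forall i j, 0 <= R i j) -> orthant y ->
  orthant (R *m y).
Proof. by move=> R0 y0 i; rewrite mxE sumr_ge0// => j _; rewrite mulr_ge0. Qed.

(** Since [R] is non-negative, [R *m x] is monotone in [x] and [R *m y] is non-negative, so the
    pairing combines the entries of [R *m x] with non-negative weights. *)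
Lemma pairing_mono x x' y : (forall i j, 0 <= R i j) -> orthant y ->
  (forall i, x i 0 <= x' i 0) -> pairing p R x y <= pairing p R x' y.
Proof.
move=> R0 y0 xx'; have b0 := orthant_mulmx R0 y0.
have a0 i : (R *m x) i 0 <= (R *m x') i 0.
  by rewrite !mxE ler_sum// => j _; rewrite ler_wpM2l.
case: exponentP => [|r r1|].
- rewrite /pairing eqxx ler_wpM2l ?sum_wnorm1 ?sumr_ge0//.
  by apply: ler_sum => i _; rewrite ler_wpM2l// sgr_ge0.
- rewrite /pairing (gt_eqF r1); case: ifP => _ //.
  rewrite ler_wpM2l ?powR_ge0//.
  by apply: ler_sum => i _; rewrite ler_wpM2l// mulr_ge0// powR_ge0.
- have [n0|n0] := posnP n; first by rewrite !pairing_infty0.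
  have [i [iy -> _]] := pairing_infty_attained x y n0.
  have [_ [_ _ /(_ _ iy)]] := pairing_infty_attained x' y n0.
  by apply: le_trans; rewrite ler_wpM2l.
Qed.

(** The triangle inequality follows from the pairing: expanding [[x + y, x + y]] in its first
    argument bounds the square of the norm of [x + y] by that norm times the sum of the two
    norms. *)
Lemma wnorm_is_norm : is_norm (wnorm p R).
Proof.
split; [exact: wnorm_ge0|exact: wnorm_eq0|exact: wnormZ|move=> x y].
have [xy0|/eqP xy0] := pselect (x + y = 0).
  by rewrite xy0 wnorm0 addr_ge0 ?wnorm_ge0.
rewrite -(ler_pM2r (wnorm_gt0 xy0)) -expr2 -pairing_diag mulrDl.
by apply: le_trans (pairingD _ _ _) _; rewrite lerD// pairing_le.
Qed.

End pairing_theory.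

(** * Norms on column vectors and the conic measure *)

Lemma ler_mx_norm (K : realType) (m n : nat) (x : 'M[K]_(m, n)) i j :
  `|x i j| <= `|x|.
Proof. by rewrite [leRHS]mx_normrE; exact: (le_bigmax _ _ (i, j)). Qed.

Lemma mx_norm_le (K : realType) (m n : nat) (x : 'M[K]_(m, n)) (e : K) :
  0 <= e -> (forall i j, `|x i j| <= e) -> `|x| <= e.
Proof.
by move=> e0 h; rewrite [leLHS]mx_normrE; apply: bigmax_le => // -[i j] _.
Qed.

Lemma cvg_mx (K : realType) (T : Type) (F : set_system T) (m n : nat)
    (f : T -> 'M[K]_(m, n)) (l : 'M[K]_(m, n)) {FF : Filter F} :
  (forall i j, f t i j @[t --> F] --> l i j) -> f @ F --> l.
Proof.
move=> fl; apply/cvgrPdist_le => /= e e0.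
have : \forall t \near F, forall ij : 'I_m * 'I_n,
    `|l ij.1 ij.2 - f t ij.1 ij.2| <= e.
  by apply: filter_forall => ij; have /cvgrPdist_le := fl ij.1 ij.2; exact.
apply: filterS => t h; apply: mx_norm_le (ltW e0) _ => i j.
by rewrite !mxE; exact: (h (i, j)).
Qed.

Section norms.
Context (K : realType) (k : nat) (N : 'cV[K]_k -> K).

(** Expansion in the canonical basis. It is stated for seminorms because it is also applied to [x]
    mapped to the norm of [B *m x], where [B] may be singular. *)
Lemma seminorm_le : (forall a v, N (a *: v) = `|a| * N v) ->
  (forall v w, N (v + w) <= N v + N w) ->
  exists2 C, 0 < C & forall v, N v <= C * `|v|.
Proof.
move=> NZ ND; have N0 v : 0 <= N v.
  have := ND v (- v); rewrite subrr -(scale0r v) NZ normr0 mul0r.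
  by rewrite -scaleN1r NZ normrN1 mul1r; lra.
exists (1 + \sum_i N (delta_mx i 0)) => [|v].
  by rewrite ltr_pwDl// sumr_ge0.
have {1}-> : v = \sum_i v i 0 *: delta_mx i 0.
  rewrite {1}[v]matrix_sum_delta; apply: eq_bigr => i _.
  by rewrite big_ord1.
have : N (\sum_i v i 0 *: delta_mx i 0) <= \sum_i `|v i 0| * N (delta_mx i 0).
  elim/big_ind2 : _ => [|x y x' y' h h'|i _]; last by rewrite NZ.
    by rewrite -(scale0r 0) NZ normr0 mul0r.
  by apply: le_trans (ND _ _) _; exact: lerD.
move=> /le_trans; apply; rewrite mulrDl mul1r mulr_suml ler_wpDl//.
by apply: ler_sum => i _; rewrite mulrC ler_wpM2l// ler_mx_norm.
Qed.

Hypothesis N_norm : is_norm N.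

Lemma is_norm_le : exists2 C, 0 < C & forall v, N v <= C * `|v|.
Proof. by case: N_norm => _ _; exact: seminorm_le. Qed.

Lemma is_norm0 : N 0 = 0.
Proof.
by case: N_norm => _ _ NZ _; rewrite -(scale0r 0) NZ normr0 mul0r.
Qed.

Lemma is_norm_continuous : continuous N.
Proof.
have [C C0 NC] := is_norm_le; case: (N_norm) => N0 _ NZ ND.
move=> x; apply/(@cvgrPdist_lt _ _ _ (nbhs x)) => e e0.
have eC : 0 < e / C by exact: divr_gt0.
near=> y.
have xy : `|x - y| < e / C.
  by near: y; have /cvgrPdist_lt := @cvg_id _ (nbhs x); exact.
have : N (x - y) < e.
  by apply: le_lt_trans (NC _) _; rewrite mulrC -ltr_pdivlMr.
apply: le_lt_trans; rewrite ler_norml; apply/andP; split.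
  have := ND (- (x - y)) x; rewrite opprB subrK -opprB -scaleN1r NZ normrN1.
  by lra.
by have := ND (x - y) y; rewrite subrK; lra.
Unshelve. all: by end_near. Qed.

(** Equivalence of norms in finite dimension: [N] attains a positive minimum on the compact unit
    sphere of the max norm, and homogeneity extends the bound to all vectors. *)
Lemma is_norm_ge : exists2 L, 0 < L & forall v, `|v| <= L * N v.
Proof.
case: (N_norm) => N0 Neq0 NZ ND.
pose S := [set v : 'cV[K]_k | `|v| = 1].
have Nv1 v : v != 0 -> S (`|v|^-1 *: v).
  by move=> v0; rewrite /S /= normrZ normfV normr_id mulVf// normr_eq0.
(* The sphere is empty exactly when every vector is zero, and then any constant works. *)
have [[v0 Sv0]|Sempty] := pselect (S !=set0); last first.
  exists 1 => // v; have [->|/Nv1 Sv] := eqVneq v 0.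
    by rewrite normr0 mul1r.
  by exfalso; apply: Sempty; exists (`|v|^-1 *: v).
(* Compactness is obtained for row vectors and carried over by transposition, which is continuous
   and preserves the max norm. *)
have trmx_norm (v : 'rV[K]_k) : `|v^T| = `|v|.
  apply/eqP; rewrite eq_le; apply/andP; split; apply: mx_norm_le => // i j.
    by rewrite mxE ler_mx_norm.
  by rewrite -[X in `|X|](mxE trmx_key (fun i j => v j i)) ler_mx_norm.
have trmx_cont : continuous (fun v : 'rV[K]_k => v^T).
  move=> v; apply: (@cvg_mx _ _ (nbhs v)) => i j; rewrite mxE.
  under eq_fun do rewrite mxE; exact: coord_continuous.
have cS : compact S.
  have -> : S = (fun v : 'rV[K]_k => v^T) @` [set v | `|v| = 1].
    apply/seteqP; split => [v Sv|_ [v v1 <-]]; last by rewrite /S /= trmx_norm.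
    by exists v^T; rewrite /= ?trmxK// -trmx_norm trmxK.
  apply: continuous_compact; first exact: continuous_subspaceT.
  apply: bounded_closed_compact.
    by exists 1; split => // M M1 v /= ->; exact: ltW.
  have -> : [set v : 'rV[K]_k | `|v| = 1] = (fun v => `|v|) @^-1` [set 1] by [].
  apply: closed_comp => [v _|]; first exact: norm_continuous.
  exact: closed_eq.
have Sne : S !=set0 by exists v0.
have [m mS Nm] := compact_EVT_min Sne cS
  (continuous_subspaceT is_norm_continuous).
have Nm0 : 0 < N m.
  rewrite lt_neqAle N0 andbT eq_sym; apply/eqP => /Neq0 m0.
  by move: mS; rewrite inE m0 /S /= normr0 => /eqP; rewrite eq_sym oner_eq0.
exists (N m)^-1; first by rewrite invr_gt0.
move=> v; have [->|v0'] := eqVneq v 0.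
  by rewrite normr0 is_norm0 mulr0.
have := Nm _ (mem_set (Nv1 _ v0')); rewrite NZ normfV normr_id.
have nv : 0 < `|v| by rewrite normr_gt0.
by rewrite ler_pdivlMl// mulrC -ler_pdivlMl.
Qed.

End norms.

(** * Difference quotients of the norm and the pairing *)

Section conic.
Context (K : realType) (n : nat) (p : \bar K) (p_ge1 : (1 <= p)%E).
Context (R : 'M[K]_n) (R_unit : R \in unitmx).

(** For nonzero [v], the pairing divided by the squared norm is at most the difference quotient at
    [v] for every small positive [h], hence at most the supremum over the orthant and its limit. *)
Lemma conic_measure_pairing (B : 'M[K]_n) (v : 'cV[K]_n) (c : K) :
  orthant v -> conic_measure p R B <= - c ->
  pairing p R (B *m v) v <= - c * wnorm p R v ^+ 2.
Proof.
move=> v0 Bc; have [ve0|vn0] := eqVneq v 0.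
  apply: le_trans (pairing_le p_ge1 R_unit _ _) _.
  by rewrite ve0 (wnorm0 p_ge1) expr0n !mulr0.
pose N := wnorm p R.
have [N0 _ NZ ND] : is_norm N := wnorm_is_norm p_ge1 R_unit.
have Ngt0 : forall x, x != 0 -> 0 < N x := wnorm_gt0 p_ge1 R_unit.
have Nv := Ngt0 _ vn0.
(* [M] bounds the operator norm of [B]. It bounds the quotients above, so that each supremum is a
   genuine one, and below, so that the limit exists. *)
have [M M0 NB] : exists2 M, 0 < M & forall x, N (B *m x) <= M * N x.
  have [C C0 NC] : exists2 C, 0 < C & forall x, N (B *m x) <= C * `|x|.
    by apply: seminorm_le => [a x|x y]; rewrite /N -?scalemxAr ?mulmxDr.
  have [L L0 NL] := is_norm_ge (wnorm_is_norm p_ge1 R_unit).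
  exists (C * L) => [|x]; first exact: mulr_gt0.
  by apply: le_trans (NC x) _; rewrite -mulrA ler_pM2l.
pose q (h : K) x := (N ((1%:M + h *: B) *m x) / N x - 1) / h.
pose E (h : K) := [set q h x | x in [set x : 'cV[K]_n | orthant x /\ x != 0]].
have actE h x : (1%:M + h *: B) *m x = x + h *: (B *m x).
  by rewrite mulmxDl mul1mx scalemxAl.
have qM h x : 0 < h -> x != 0 -> - M <= q h x <= M.
  move=> h0 x0; have Nx := Ngt0 _ x0; rewrite /q actE.
  have hB : N (h *: (B *m x)) <= h * M * N x.
    by rewrite NZ gtr0_norm// -mulrA ler_pM2l.
  rewrite ler_pdivlMr// ler_pdivrMr// lerBrDr lerBlDr ler_pdivlMr//.
  rewrite ler_pdivrMr//; apply/andP; split.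
    have := ND (x + h *: (B *m x)) (- (h *: (B *m x))).
    rewrite addrK -scaleN1r NZ normrN1 mul1r -/N; move: hB.
    by rewrite -/N; nra.
  by apply: le_trans (ND _ _) _; move: hB; rewrite -/N; nra.
(* Convexity: [x + h *: (B *m x)] is a convex combination of [x] and [x + h' *: (B *m x)] with
   weights [1 - h / h'] and [h / h']. *)
have q_homo h h' x : 0 < h -> h <= h' -> x != 0 -> q h x <= q h' x.
  move=> h0 hh' x0; have Nx := Ngt0 _ x0.
  have h'0 : 0 < h' by apply: lt_le_trans hh'.
  rewrite /q !actE ler_pdivlMr// mulrAC ler_pdivrMr//.
  have -> : x + h *: (B *m x) =
      (1 - h / h') *: x + (h / h') *: (x + h' *: (B *m x)).
    rewrite scalerDr scalerA divfK ?gt_eqF// addrA -scalerDl subrK.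
    by rewrite scale1r.
  have hh1 : h / h' <= 1 by rewrite ler_pdivrMr// mul1r.
  have := ND ((1 - h / h') *: x) ((h / h') *: (x + h' *: (B *m x))).
  rewrite !NZ !ger0_norm ?divr_ge0 ?(ltW h0) ?(ltW h'0) ?subr_ge0// -/N => ND'.
  set y := x + h' *: _.
  have : N ((1 - h / h') *: x + (h / h') *: y) / N x <=
      1 - h / h' + h / h' * (N y / N x).
    by rewrite ler_pdivrMr// mulrDl -[X in _ <= _ + X]mulrA divfK// gt_eqF.
  set a := N _ / N x; set b := N y / N x => ab.
  rewrite -(@ler_pM2r _ h'^-1) ?invr_gt0// mulfK ?gt_eqF//.
  by rewrite mulrAC -mulrA; lra.
have supE h x : 0 < h -> orthant x -> x != 0 -> q h x <= sup (E h).
  move=> h0 xo x0; apply: ub_le_sup; last by exists x.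
  by exists M => _ [y [_ y0] <-]; have /andP[] := qM h y h0 y0.
have vE h : E h !=set0 by exists (q h v); exists v.
have cvgE : cvg (sup (E h) @[h --> 0^'+]).
  apply: nondecreasing_at_right_is_cvgr.
    near=> x => h h'; rewrite !in_itv /= => /andP[h0 _] /andP[h'0 _] hh'.
    apply: ge_sup; first exact: vE.
    move=> _ [y [yo y0] <-]; apply: le_trans (supE h' y h'0 yo y0).
    exact: q_homo.
  apply: nearW => x; exists (- M) => y [h /=].
  rewrite in_itv /= => /andP[h0 _] <-.
  apply: le_trans (supE h v h0 v0 vn0).
  by have /andP[] := qM h v h0 vn0.
suff : pairing p R (B *m v) v / N v ^+ 2 <= - c.
  by rewrite ler_pdivrMr// exprn_gt0.
apply: le_trans Bc; apply: limr_ge; first exact: cvgE.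
near=> h; have h0 : 0 < h by [].
apply: le_trans (supE h v h0 v0 vn0).
rewrite /q actE ler_pdivlMr// lerBrDr.
have le1 := pairing_le p_ge1 R_unit (v + h *: (B *m v)) v.
have := pairingD p_ge1 R (v + h *: (B *m v)) (- v) v.
rewrite addrAC subrr add0r => le2.
have le3 := pairingN_diag p_ge1 R v.
(* Homogeneity is available as an inequality, so it is applied with factor [h^-1] to [h *: (B *m v)]
   to bound the pairing of [B *m v] from above. *)
have h0' : 0 <= h^-1 by rewrite invr_ge0 ltW.
have := pairingZ p_ge1 R (h *: (B *m v)) v h0'.
rewrite scalerA mulVf ?gt_eqF// scale1r -/N in le1 le3 * => le4.
have : pairing p R (B *m v) v * h <= N (v + h *: (B *m v)) * N v - N v ^+ 2.
  rewrite -ler_pdivlMr// mulrC; apply: le_trans le4 _.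
  by rewrite ler_wpM2l//; lra.
move: (pairing _ _ _ _) (N (v + _)) (N v) Nv => a d e e0 H.
rewrite ler_pdivlMr// (_ : _ * e = (a * h + e ^+ 2) / e).
  by rewrite ler_pdivrMr//; lra.
by field; rewrite gt_eqF.
Unshelve. all: by end_near. Qed.

End conic.

(** * Comparison with a linear differential equation *)

(** Differentiability read on increments to the left with an explicit error, the form that left Dini
    estimates require. *)
Lemma is_derive_backward (K : realType) (W : normedModType K) (f : K -> W)
    (t : K) (d : W) (e : K) : is_derive t 1 f d -> 0 < e ->
  exists2 r, 0 < r & forall h, 0 < h -> h < r ->
    `|f t - f (t - h) - h *: d| <= h * e.
Proof.
move=> [dft dfE] e0.
have : (fun h => h^-1 *: (f (h *: 1 + t) - f t)) @ 0^' --> d.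
  by rewrite -dfE; exact: dft.
move=> /cvgrPdist_le /(_ _ e0) [r /= r0 H]; exists r => // h h0 hr.
have := H (- h); rewrite /= sub0r opprK gtr0_norm// oppr_eq0 gt_eqF//.
move=> /(_ hr isT).
rewrite scaleNr [_ *: 1]mulr1 (addrC (- h)) invrN scaleNr opprK.
rewrite -(ler_pM2l h0) -{1}(gtr0_norm h0) -normrZ scalerDr scalerA.
rewrite divff ?gt_eqF// scale1r -normrN !opprD opprK.
by rewrite [X in _ -> `|X| <= _]addrC (addrC (f t)).
Qed.

(* At a positive maximum of phi minus the solution psi of psi' = - c psi + M
   with psi(0) = phi(0), the left difference quotient of phi - psi would be
   both nonnegative and at most - c (phi - psi) < 0 in the limit. *)
Lemma left_dini_comparison (K : realType) (phi : K -> K) (t1 c M : K) :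
  0 <= t1 -> 0 < c -> 0 <= M -> 0 <= phi 0 ->
  {within `[0, t1], continuous phi} ->
  (forall t e : K, 0 < t -> t <= t1 -> 0 < phi t -> 0 < e ->
    exists2 r, 0 < r & forall h, 0 < h -> h < r ->
      phi t - phi (t - h) <= h * (- c * phi t + M + e)) ->
  phi t1 <= expR (- c * t1) * phi 0 + (1 - expR (- c * t1)) / c * M.
Proof.
move=> t10 c0 M0 phi0 phic dini.
pose psi (t : K) : K := M / c + expR (- c * t) * (phi 0 - M / c).
have psiE t : psi t = expR (- c * t) * phi 0 + (1 - expR (- c * t)) / c * M.
  by rewrite /psi; field; rewrite gt_eqF.
have psi0 t : 0 <= t -> 0 <= psi t.
  move=> t0; rewrite psiE addr_ge0// mulr_ge0 ?expR_ge0//.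
  rewrite divr_ge0 ?(ltW c0)// subr_ge0 expR_le1 mulNr oppr_le0.
  by rewrite mulr_ge0// ltW.
have dpsi (t : K) : is_derive t (1 : K) psi (- c * psi t + M).
  have dl : is_derive t (1 : K) (fun s : K => - c * s) (- c).
    apply: (@is_derive_eq _ _ _ (- c \*: @id K)).
    by rewrite /GRing.scale /= mulr1.
  have de : is_derive t (1 : K) (expR \o (fun s : K => - c * s))
      (expR (- c * t) * - c).
    exact: is_derive1_comp.
  have := is_deriveD (is_derive_cst (M / c) t 1)
    (is_deriveZ (phi 0 - M / c) de).
  rewrite (_ : cst _ + _ = psi); last first.
    by apply/funext => s; rewrite /psi; congr (_ + _); exact: mulrC.
  move/is_derive_eq; apply; rewrite /psi /GRing.scale /=; field.
  by rewrite gt_eqF.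
have psic : continuous psi.
  move=> t; apply/differentiable_continuous/derivable1_diffP.
  by have [] := dpsi t.
rewrite -psiE -subr_le0 leNgt; apply/negP => pos.
have dc : {within `[0, t1], continuous (fun t => phi t - psi t)}.
  move=> t; apply: cvgB; first exact: phic.
  exact: (continuous_subspaceT psic).
have [m + mmax] := EVT_max t10 dc; rewrite in_itv /= => /andP[m0 mt1].
have mpos : 0 < phi m - psi m.
  by apply: lt_le_trans pos _; apply: mmax; rewrite in_itv /= t10 lexx.
have mgt0 : 0 < m.
  rewrite lt_neqAle m0 andbT eq_sym; apply/eqP => me0; move: mpos.
  by rewrite me0 /psi mulr0 expR0 mul1r addrCA subrr addr0 subrr ltxx.
(* The Dini hypothesis holds only where [phi] is positive; this is ensured at [m] because [psi] is
   non-negative. *)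
have phim : 0 < phi m by have := psi0 _ m0; lra.
set D := phi m - psi m in mpos mmax.
(* Two errors of this size, one for [phi] and one for [psi], use up only half of the decrease
   [c * D]. *)
have e0 : 0 < c * D / 4 by rewrite divr_gt0// mulr_gt0.
have [r r0 Hr] := dini _ _ mgt0 mt1 phim e0.
have [r' r'0 Hr'] := is_derive_backward (dpsi m) e0.
(* Halving the minimum puts [h] strictly below both radii and keeps [m - h] inside the interval. *)
pose h := Num.min m (Num.min r r') / 2.
have h0 : 0 < h by rewrite divr_gt0// !lt_min mgt0 r0 r'0.
have hlt : h < Num.min m (Num.min r r').
  by rewrite /h ltr_pdivrMr//; move: h0; rewrite /h; lra.
move: hlt; rewrite !lt_min => /and3P[hm hr hr'].
have {}Hr := Hr h h0 hr.
have Hpsi : - (h * (c * D / 4)) <=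
    psi m - psi (m - h) - h * (- c * psi m + M).
  by have := Hr' h h0 hr'; rewrite ler_norml => /andP[].
have : phi (m - h) - psi (m - h) <= D.
  by apply: mmax; rewrite in_itv /=; apply/andP; split; lra.
(* The two estimates make [D] minus the difference at [m - h] at most [- h * (c * D / 2)], while
   maximality makes it non-negative. *)
have : 0 < h * (c * D / 2) by rewrite mulr_gt0// divr_gt0// mulr_gt0.
move: Hr Hpsi; rewrite /D; lra.
Qed.

(** * Decay of the weighted norm under a differential inequality *)

Section comparison.
Context (K : realType) (n : nat) (p : \bar K) (p_ge1 : (1 <= p)%E).
Context (R : 'M[K]_n) (R_unit : R \in unitmx) (R_ge0 : forall i j, 0 <= R i j).

Lemma wnorm_left_dini (w : K -> 'cV[K]_n) (t c M e : K) (d F b : 'cV[K]_n) :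
  is_derive t 1 w d -> orthant (w t) -> 0 < wnorm p R (w t) ->
  (forall i, d i 0 <= F i 0 + b i 0) ->
  pairing p R F (w t) <= - c * wnorm p R (w t) ^+ 2 ->
  wnorm p R b <= M -> 0 < e ->
  exists2 r, 0 < r & forall h, 0 < h -> h < r ->
    wnorm p R (w t) - wnorm p R (w (t - h)) <=
    h * (- c * wnorm p R (w t) + M + e).
Proof.
move=> dw wt0 N0 dFb HF bM e0.
have [C C0 NC] := is_norm_le (wnorm_is_norm p_ge1 R_unit).
(* The max-norm error [e / C] becomes [e] in the weighted norm. *)
have [r r0 Hr] := is_derive_backward dw (divr_gt0 e0 C0).
exists r => // h h0 hr; set y := w t in wt0 N0 HF *.
pose z := w t - w (t - h) - h *: d.
have Nz : wnorm p R z <= h * e.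
  apply: le_trans (NC _) _; rewrite mulrC -ler_pdivlMr// -mulrA.
  exact: Hr.
have yE : y = w (t - h) + (h *: d + z).
  by rewrite /z !subrKC.
have D1 := pairingD p_ge1 R (w (t - h)) (h *: d + z) y.
have D2 := pairingD p_ge1 R (h *: d) z y.
have D3 := pairingZ p_ge1 R d y (ltW h0).
have D4 := le_trans (pairing_mono p_ge1 R_ge0 wt0
  (x' := F + b) (fun i => ltac:(by rewrite mxE))) (pairingD p_ge1 R F b y).
have D5 := pairing_le p_ge1 R_unit b y.
have D6 := pairing_le p_ge1 R_unit z y.
have D7 := pairing_le p_ge1 R_unit (w (t - h)) y.
rewrite -yE (pairing_diag p_ge1) in D1.
have D8 : wnorm p R b * wnorm p R y <= M * wnorm p R y by rewrite ler_pM2r.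
have D9 : wnorm p R z * wnorm p R y <= h * e * wnorm p R y by rewrite ler_pM2r.
have D10 : h * pairing p R d y <=
    h * (- c * wnorm p R y ^+ 2 + M * wnorm p R y).
  by rewrite ler_pM2l//; lra.
(* The pairing estimates all carry the factor [wnorm p R y], so the goal is multiplied by it. *)
rewrite -(ler_pM2r N0); rewrite expr2 in D1 D10; lra.
Qed.

(** [d] and [b] are arbitrary functions of time, so the statement serves both the storage vector
    under an input and the comparison system without one. *)
Lemma wnorm_comparison (w d b : K -> 'cV[K]_n) (F : 'cV[K]_n -> 'cV[K]_n)
    (t1 c M : K) : 0 <= t1 -> 0 < c -> 0 <= M ->
  {within `[0, t1], continuous w} ->
  (forall t, 0 < t -> t <= t1 -> orthant (w t)) ->
  (forall t, 0 < t -> t <= t1 -> is_derive t 1 w (d t)) ->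
  (forall t i, 0 < t -> t <= t1 -> d t i 0 <= F (w t) i 0 + b t i 0) ->
  (forall t, 0 < t -> t <= t1 -> wnorm p R (b t) <= M) ->
  (forall v, orthant v -> pairing p R (F v) v <= - c * wnorm p R v ^+ 2) ->
  wnorm p R (w t1) <= expR (- c * t1) * wnorm p R (w 0) +
                      (1 - expR (- c * t1)) / c * M.
Proof.
move=> t10 c0 M0 wc w0 dw dFb bM HF.
apply: (@left_dini_comparison _ (wnorm p R \o w)) => //.
- exact: wnorm_ge0.
- move=> t; apply: (continuous_comp (wc t)).
  exact/is_norm_continuous/wnorm_is_norm.
- move=> t e t0 tt1 /= Nt e0.
  apply: (wnorm_left_dini (dw _ t0 tt1) (w0 _ t0 tt1) Nt _ (HF _ (w0 _ t0 tt1))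
    (bM _ t0 tt1) e0).
  by move=> i; exact: dFb.
Qed.

End comparison.

(** * Storage functions along trajectories *)

Lemma is_derive_mx (K : realType) (m n : nat) (M : K -> 'M[K]_(m, n)) (t : K)
    (d : 'M[K]_(m, n)) :
  (forall i j, is_derive t 1 (fun s => M s i j) (d i j)) -> is_derive t 1 M d.
Proof.
move=> dM; have derM : derivable M t 1.
  by apply/derivable_mxP => i j; have [] := dM i j.
split => //; rewrite derive_mx//; apply/matrixP => i j; rewrite mxE.
by have [] := dM i j.
Qed.

Lemma submxcol_continuous (K : realType) (n : nat) (Nd : 'I_n -> nat)
    (i : 'I_n) :
  continuous (fun x : 'cV[K]_(\sum_j Nd j) => submxcol x i).
Proof.
move=> x; apply: (@cvg_mx _ _ (nbhs x)) => k j; rewrite mxE.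
have -> : (fun y : 'cV[K]_(\sum_j Nd j) => submxcol y i k j) =
    (fun y => y (tagnat.Rank i k) j) by apply/funext => y; rewrite mxE.
exact: coord_continuous.
Qed.

Lemma storage_continuous (K : realType) (n : nat) (Nd : 'I_n -> nat)
    (V : forall i, 'cV[K]_(Nd i) -> K) :
  (forall i, continuous (V i)) -> continuous (storage V).
Proof.
move=> Vc x; apply: (@cvg_mx _ _ (nbhs x)) => i j; rewrite mxE.
have -> : (fun y => storage V y i j) = (fun y => V i (submxcol y i)).
  by apply/funext => y; rewrite mxE.
apply: (@continuous_comp _ _ _ (fun x => submxcol x i) (V i)).
  exact: submxcol_continuous.
exact: Vc.
Qed.

Lemma is_derive_storage (K : realType) (n : nat) (Nd Md : 'I_n -> nat)
    (f : forall i, 'cV[K]_(\sum_j Nd j) -> 'cV[K]_(Md i) -> 'cV[K]_(Nd i))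
    (V : forall i, 'cV[K]_(Nd i) -> K) (T : \bar K)
    (u : K -> 'cV[K]_(\sum_j Md j)) (x : K -> 'cV[K]_(\sum_j Nd j)) (t : K) :
  (forall i y, differentiable (V i) y) -> trajectory f T u x ->
  0 < t -> (t%:E < T)%E ->
  is_derive t 1 (storage V \o x)
    (\col_i 'D_(f i (x t) (submxcol (u t) i)) (V i) (submxcol (x t) i)).
Proof.
move=> Vd [_ dx] t0 tT; apply: is_derive_mx => i j; rewrite mxE.
have -> : (fun s => (storage V \o x) s i j) =
    V i \o (fun s => submxcol (x s) i).
  by apply/funext => s; rewrite /= mxE.
have [dxi dxiE] := dx t i t0 tT.
have dfi : differentiable (fun s => submxcol (x s) i) t.
  exact/derivable1_diffP.
have dVi := Vd i (submxcol (x t) i).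
have dcomp : differentiable (V i \o (fun s => submxcol (x s) i)) t.
  exact: differentiable_comp.
split; first exact/derivable1_diffP.
rewrite [LHS]deriveE// diff_comp// deriveE//= -dxiE.
by rewrite [X in _ = 'd _ _ X]deriveE.
Qed.

(** Divergence of [alpha] bounds the set whose supremum is [kinv alpha s], so its element [r] lies
    below that supremum. *)
Lemma kinv_ge (K : realType) (alpha : K -> K) (r s : K) : class_Kinfty alpha ->
  0 <= r -> alpha r <= s -> r <= kinv alpha s.
Proof.
move=> [_ /cvgryPgt /(_ s) [M [_ HM]]] r0 rs; apply: ub_le_sup => //.
exists M => q [_ qs]; rewrite leNgt; apply/negP => /HM.
by rewrite ltNge qs.
Qed.

Lemma class_K_ge0 (K : realType) (alpha : K -> K) (r : K) :
  class_K alpha -> 0 <= r -> 0 <= alpha r.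
Proof.
move=> [a0 mono]; rewrite le_eqVlt => /predU1P[<-|r0]; first by rewrite a0.
by rewrite -a0 ltW// mono.
Qed.

Lemma class_K_le (K : realType) (alpha : K -> K) (r s : K) :
  class_K alpha -> 0 <= r -> r <= s -> alpha r <= alpha s.
Proof.
move=> [_ mono] r0; rewrite le_eqVlt => /predU1P[->//|rs].
exact/ltW/mono.
Qed.

Lemma horizon_subset (K : realType) (T : \bar K) (t : K) :
  horizon T t -> `[0, t] `<=` horizon T.
Proof.
move=> [t0 tT] s /=; rewrite in_itv /= => /andP[s0 st]; split => //.
by apply: le_lt_trans tT; rewrite lee_fin.
Qed.

(** * Exponential bound on the storage vector *)

Section estimates.
Context (K : realType) (n : nat) (p : \bar K) (p_ge1 : (1 <= p)%E).
Context (R : 'M[K]_n) (R_unit : R \in unitmx) (R_ge0 : forall i j, 0 <= R i j).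

(** The gains may be discontinuous, so the extreme value theorem is applied to [nu \o u] and
    monotonicity of each [gamma i] transfers the bound. *)
Lemma input_has_ubound (m : nat) (nu : 'cV[K]_m -> K) (gamma : 'I_n -> K -> K)
    (T : \bar K) (u : K -> 'cV[K]_m) (t : K) :
  is_norm nu -> (forall i, class_K (gamma i)) ->
  {within horizon T, continuous u} -> horizon T t ->
  has_ubound [set wnorm p R (input_map nu gamma (u tau)) | tau in `[0, t]].
Proof.
move=> nuN gK uc tT; have [C C0 NC] := is_norm_le (wnorm_is_norm p_ge1 R_unit).
have nuc : {within `[0, t], continuous (nu \o u)}.
  have uc' := continuous_subspaceW (horizon_subset tT) uc.
  by move=> s; apply: (continuous_comp (uc' s)); exact: is_norm_continuous.
have [m0 _ numax] := EVT_max tT.1 nuc.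
have nu0 v : 0 <= nu v by case: nuN.
exists (C * \sum_i gamma i (nu (u m0))) => _ [s /= st <-].
apply: le_trans (NC _) _; rewrite ler_pM2l//.
have g0 i : 0 <= gamma i (nu (u m0)) by exact: class_K_ge0.
apply: mx_norm_le => [|i j]; first exact: sumr_ge0.
rewrite mxE ger0_norm ?class_K_ge0//.
apply: (@le_trans _ _ (gamma i (nu (u m0)))).
  by apply: class_K_le => //; exact: numax.
by rewrite (bigD1 i)//= lerDl sumr_ge0.
Qed.

Lemma storage_wnorm_bound (Nd Md : 'I_n -> nat)
    (f : forall i, 'cV[K]_(\sum_j Nd j) -> 'cV[K]_(Md i) -> 'cV[K]_(Nd i))
    (nu : 'cV[K]_(\sum_j Md j) -> K) (gamma : 'I_n -> K -> K)
    (V : forall i, 'cV[K]_(Nd i) -> K) (F : 'cV[K]_n -> 'cV[K]_n) (c : K) :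
  is_norm nu -> (forall i, class_K (gamma i)) ->
  (forall i y, 0 <= V i y) -> (forall i y, differentiable (V i) y) ->
  (forall i x u, 'D_(f i x (submxcol u i)) (V i) (submxcol x i) <=
    F (storage V x) i 0 + gamma i (nu u)) ->
  0 < c ->
  (forall v, orthant v -> pairing p R (F v) v <= - c * wnorm p R v ^+ 2) ->
  forall (T : \bar K) (u : K -> 'cV[K]_(\sum_j Md j))
      (x : K -> 'cV[K]_(\sum_j Nd j)) (t : K),
    {within horizon T, continuous u} -> trajectory f T u x -> horizon T t ->
    wnorm p R (storage V (x t)) <=
      expR (- c * t) * wnorm p R (storage V (x 0)) + (1 - expR (- c * t)) / c *
        sup [set wnorm p R (input_map nu gamma (u tau)) | tau in `[0, t]].
Proof.
move=> nuN gK V0 Vd VF c0 HF T u x t uc trj tT.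
have ub := input_has_ubound nuN gK uc tT.
have supN s : 0 <= s -> s <= t ->
    wnorm p R (input_map nu gamma (u s)) <=
    sup [set wnorm p R (input_map nu gamma (u tau)) | tau in `[0, t]].
  move=> s0 st; apply: ub_le_sup => //; exists s => //=.
  by rewrite in_itv /= s0.
have sT s : s <= t -> (s%:E < T)%E.
  by move=> st; apply: le_lt_trans tT.2; rewrite lee_fin.
have Vc i : continuous (V i) by move=> y; exact: differentiable_continuous.
apply: (wnorm_comparison p_ge1 R_unit R_ge0
  (w := storage V \o x) (F := F) (b := fun s => input_map nu gamma (u s))) => //.
- by case: tT.
(* The supremum is non-negative because it dominates the norm of the input term at time 0. *)
- by apply: le_trans (supN 0 _ _); rewrite ?(wnorm_ge0 p_ge1)//; case: tT.
- have xc := continuous_subspaceW (horizon_subset tT) trj.1.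
  by move=> s; apply: (continuous_comp (xc s)); exact: storage_continuous.
- by move=> s _ _ i; rewrite mxE.
- by move=> s s0 st; exact: (is_derive_storage Vd trj s0 (sT s st)).
- by move=> s i s0 st /=; rewrite !mxE.
- by move=> s s0 st; apply: supN => //; exact: ltW.
Qed.

End estimates.

Lemma mx_norm_submxcol_le (K : realType) (n : nat) (Nd : 'I_n -> nat)
    (x : 'cV[K]_(\sum_j Nd j)) (e : K) :
  0 <= e -> (forall i, `|submxcol x i| <= e) -> `|x| <= e.
Proof.
move=> e0 h; apply: mx_norm_le => // s j.
rewrite -[x]submxcolK mxE.
by apply: le_trans (ler_mx_norm _ _ _) (h _).
Qed.

(** * Exponential convergence and input-to-state stability *)

Theorem propositionV4 (K : realType) (n : nat) (Nd Md : 'I_n -> nat)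
    (f : forall i, 'cV[K]_(\sum_j Nd j) -> 'cV[K]_(Md i) -> 'cV[K]_(Nd i))
    (f0 : forall i, f i 0 0 = 0)
    (normx : forall i, 'cV[K]_(Nd i) -> K)
    (normx_norm : forall i, is_norm (normx i))
    (normu : 'cV[K]_(\sum_j Md j) -> K)
    (normu_norm : is_norm normu)
    (V : forall i, 'cV[K]_(Nd i) -> K)
    (V_ge0 : forall i y, 0 <= V i y)
    (V_diff : forall i y, differentiable (V i) y)
    (alo ahi : 'I_n -> K -> K)
    (alo_Kinfty : forall i, class_Kinfty (alo i))
    (ahi_Kinfty : forall i, class_Kinfty (ahi i))
    (B1 : forall i y, alo i (normx i y) <= V i y <= ahi i (normx i y))
    (alpha gamma : 'I_n -> K -> K)
    (alpha_Kinfty : forall i, class_Kinfty (alpha i))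
    (gamma_Kinfty : forall i, class_Kinfty (gamma i))
    (g : 'I_n -> 'cV[K]_n -> K)
    (g0 : forall i, g i 0 = 0)
    (B2 : forall i (x : 'cV[K]_(\sum_j Nd j)) (u : 'cV[K]_(\sum_j Md j)),
      'D_(f i x (submxcol u i)) (V i) (submxcol x i)
        <= - alpha i (V i (submxcol x i)) + g i (storage V x)
           + gamma i (normu u))
    (p : \bar K) (p_ge1 : (1 <= p)%E)
    (R : 'M[K]_n) (R_unit : R \in unitmx) (R_ge0 : forall i j, 0 <= R i j)
    (c : K) (c_gt0 : 0 < c) :
  let A := diag_map alpha in
  let Gamma := gain_map g in
  let gam := input_map normu gamma in
  let C1 := forall v, orthant v ->
    - pairing p R (- A v) v >= pairing p R (Gamma v) v + c * wnorm p R v ^+ 2 in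
  let C2 := C1_within (@orthant K n) (fun v => - A v + Gamma v) /\
    exists B : 'cV[K]_n -> 'M[K]_n,
      (forall v, orthant v -> B v *m v = - A v + Gamma v) /\
      (forall v, orthant v -> conic_measure p R (B v) <= - c) in
  C1 \/ C2 ->
  [/\ (* (i) *)
      exists C lambda : K, [/\ 0 < C, 0 < lambda &
        forall (T : \bar K) (v : K -> 'cV[K]_n),
          comparison_solution A Gamma gam T (fun=> 0) v ->
          forall t, horizon T t -> `|v t| <= C * expR (- lambda * t) * `|v 0|],
      (* (ii) *)
      forall x : K -> 'cV[K]_(\sum_j Nd j),
        trajectory f +oo (fun=> 0) x ->
        x t @[t --> +oo] --> (0 : 'cV[K]_(\sum_j Nd j))
    & (* (iii) *)
      exists L : 'I_n -> K, (forall i, 0 < L i) /\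
        forall (T : \bar K) (u : K -> 'cV[K]_(\sum_j Md j))
               (x : K -> 'cV[K]_(\sum_j Nd j)),
          {within horizon T, continuous u} -> trajectory f T u x ->
          forall (i : 'I_n) (t : K), horizon T t ->
            normx i (submxcol (x t) i) <=
              kinv (alo i)
                (L i * expR (- c * t) * wnorm p R (storage V (x 0))
                 + L i * (1 - expR (- c * t)) / c
                   * sup [set wnorm p R (gam (u tau)) | tau in `[0, t]])].
Proof.
move=> A Gamma gam C1 C2 C12.
have Hgeneric v : orthant v ->
    pairing p R (- A v + Gamma v) v <= - c * wnorm p R v ^+ 2.
  move=> v0; case: C12 => [/(_ v v0) Hv|[_ [B [BE Bmu]]]].
    by apply: le_trans (pairingD p_ge1 R (- A v) (Gamma v) v) _; lra.
  by rewrite -BE//; apply: conic_measure_pairing => //; exact: Bmu.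
have gK i : class_K (gamma i) by case: (gamma_Kinfty i).
have gam0 : gam 0 = 0.
  by apply/colP => i; rewrite !mxE (is_norm0 normu_norm); case: (gK i).
have VF i x u : 'D_(f i x (submxcol u i)) (V i) (submxcol x i) <=
    (- A (storage V x) + Gamma (storage V x)) i 0 + gamma i (normu u).
  by apply: le_trans (B2 i x u) _; rewrite !mxE.
have bound := storage_wnorm_bound p_ge1 R_unit R_ge0
  (F := fun v => - A v + Gamma v) normu_norm gK V_ge0 V_diff VF c_gt0 Hgeneric.
have [C C0 NC] := is_norm_le (wnorm_is_norm p_ge1 R_unit).
have [L L0 NL] := is_norm_ge (wnorm_is_norm p_ge1 R_unit).
have V_L i x : V i (submxcol x i) <= L * wnorm p R (storage V x).
  apply: le_trans (NL _); apply: le_trans (ler_mx_norm _ i 0).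
  by rewrite mxE ler_norm.
have normx_ge0 i y : 0 <= normx i y by case: (normx_norm i).
split.
(* The factor [L * C] is the cost of passing from the max norm to the weighted norm and back; the
   rate is unchanged. *)
- exists (L * C), c; split => //; first exact: mulr_gt0.
  move=> T v [v0 vc dv] t tT.
  have Nv : wnorm p R (v t) <= expR (- c * t) * wnorm p R (v 0) +
      (1 - expR (- c * t)) / c * 0.
    apply: (wnorm_comparison p_ge1 R_unit R_ge0 (F := fun v => - A v + Gamma v)
      (b := fun=> 0) (d := fun t => - A (v t) + Gamma (v t) + gam 0)) => //.
    + by case: tT.
    + exact: continuous_subspaceW (horizon_subset tT) vc.
    + move=> s s0 st; apply: v0; split; first exact: ltW.
      by apply: le_lt_trans tT.2; rewrite lee_fin.
    + move=> s s0 st; apply: dv => //.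
      by apply: le_lt_trans tT.2; rewrite lee_fin.
    + by move=> s i _ _; rewrite gam0 !mxE.
    + by move=> s _ _; rewrite (wnorm0 p_ge1).
  apply: le_trans (NL _) _; rewrite -!mulrA ler_pM2l// mulrCA.
  apply: le_trans Nv _; rewrite mulr0 addr0 ler_pM2l ?expR_gt0//.
- move=> x trj.
  have decay t : 0 <= t -> wnorm p R (storage V (x t)) <=
      expR (- c * t) * wnorm p R (storage V (x 0)).
    move=> t0; have tT : horizon +oo%E t by split => //; rewrite ltry.
    have u0c : {within horizon +oo%E,
        continuous (fun _ : K => 0 : 'cV[K]_(\sum_j Md j))}.
      by move=> s; exact: cst_continuous.
    apply: le_trans (bound _ _ _ _ u0c trj tT) _; rewrite gerDl.
    rewrite mulr_ge0_le0//.
      rewrite divr_ge0 ?(ltW c_gt0)// subr_ge0 expR_le1 mulNr oppr_le0.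
      by rewrite mulr_ge0// ltW.
    (* For zero input the supremum is over the set containing only 0, so the input term is at most
       0. *)
    apply: ge_sup.
      by exists (wnorm p R (gam 0)), 0; rewrite //= in_itv /= lexx.
    by move=> _ [s _ <-]; rewrite -/gam gam0 (wnorm0 p_ge1).
  apply/cvgr0Pnorm_le => e e0.
  suff : forall i, \forall t \near +oo, `|submxcol (x t) i| <= e.
    move=> H; have : \forall t \near +oo, forall i, `|submxcol (x t) i| <= e.
      by apply: filter_forall => i; exact: H.
    by apply: filterS => t; apply: mx_norm_submxcol_le; exact: ltW.
  move=> i; have [Li Li0 NLi] := is_norm_ge (normx_norm i).
  have [aK _] := alo_Kinfty i.
  (* By strict monotonicity of [alo i], a storage value below [delta] forces the norm of the block
     below [e / Li], hence its max norm below [e]. *)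
  pose delta := alo i (e / Li).
  have delta0 : 0 < delta.
    by case: aK => a0 mono; rewrite /delta -a0 mono// divr_gt0.
  pose W := L * wnorm p R (storage V (x 0)).
  have W0 : 0 <= W by rewrite mulr_ge0 ?(ltW L0)// wnorm_ge0.
  (* Beyond this time [W < delta * c * t], and [1 + c * t <= expR (c * t)] then gives
     [expR (- c * t) * W < delta]. *)
  exists (W / (delta * c)); split; first exact: num_real.
  move=> t tW; have t0 : 0 < t.
    by apply: le_lt_trans tW; rewrite divr_ge0// ltW// mulr_gt0.
  apply: le_trans (NLi _) _; rewrite mulrC -ler_pdivlMr// leNgt.
  apply/negP => lt_e.
  have : alo i (e / Li) < delta; last by rewrite ltxx.
  have eLi : 0 <= e / Li by rewrite divr_ge0 ?ltW.
  case: aK => a0 mono; apply: lt_trans (mono _ _ eLi lt_e) _.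
  have /andP[le1 _] := B1 i (submxcol (x t) i).
  apply: le_lt_trans (le_trans le1 (V_L i (x t))) _.
  apply: (@le_lt_trans _ _ (expR (- c * t) * W)).
    by rewrite /W mulrCA ler_pM2l// decay// ltW.
  rewrite mulNr expRN mulrC ltr_pdivrMr ?expR_gt0//.
  apply: (@lt_le_trans _ _ (delta * (1 + c * t))); last first.
    by rewrite ler_pM2l// expR_ge1Dx.
  move: tW; rewrite ltr_pdivrMr ?mulr_gt0//; move: delta0.
  by rewrite mulrDr mulr1 mulrA (mulrC t) (mulrC delta c) -!mulrA; nra.
(* The norm-equivalence constant [L] serves all subsystems, times, inputs and trajectories at
   once. *)
- exists (fun=> L); split => // T u x uc trj i t tT.
  apply: kinv_ge => //.
  have /andP[le1 _] := B1 i (submxcol (x t) i).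
  apply: le_trans le1 (le_trans (V_L i (x t)) _).
  have -> : forall a b d s : K,
      L * a * b + L * d / c * s = L * (a * b + d / c * s).
    by move=> *; ring.
  by rewrite ler_pM2l//; exact: bound.
Qed.
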